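(* Let $\circledast$ be either the dependence atom ${=}(\ldots)$ or the anonymity atom $\Upsilon$. For all $k\ge 0$: (i) $\mathcal{PL}(\circledast_{k+1})_n\le \mathcal{PL}(\circledast_k)_{2n}$ for all $n$; (ii) $\mathcal{PL}(\circledast_{k+1})_n\not\le \mathcal{PL}(\circledast_k)_m$ for all $n,m$ with $0<n\le m<2n$; (iii) $\mathcal{PL}(\circledast_k)_n\le\mathcal{PL}(\circledast_0)_{n\cdot 2^k}$ for all $n$; (iv) $\mathcal{PL}(\circledast_k)_n\not\le\mathcal{PL}(\circledast_0)_m$ for all $n,m$ with $0<n\le m<n\cdot 2^k$. Moreover, the analogous claims (i)-(iv) with $\mathcal{PL}$ replaced everywhere by $\mathcal{QPL}$ also hold.
   Context: Let $\mathrm{Prop}$ be a countably infinite set of propositional symbols. Formulas of propositional logic $\mathcal{PL}$: $\phi::=p\mid\neg p\mid(\phi\wedge\phi)\mid(\phi\vee\phi)$ with $p\in\mathrm{Prop}$; quantified propositional logic $\mathcal{QPL}$ additionally allows $\exists p\,\phi$ and $\forall p\,\phi$. $\mathrm{FV}(\phi)$ is the set of free propositional symbols. A team $T$ over a finite set of symbols $V=\mathrm{Var}(T)$ is a set of evaluations $s:V\to\{0,1\}$. For $\bar p=p_1\dots p_k$, $s(\bar p)=s(p_1)\dots s(p_k)$. $s(a/p)$ is the evaluation that maps $p$ to $a$ and agrees with $s$ elsewhere. Semantics: $T\models p$ iff $s(p)=1$ for all $s\in T$; $T\models\neg p$ iff $s(p)=0$ for all $s\in T$; $T\models\phi\wedge\psi$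 iff $T\models\phi$ and $T\models\psi$; $T\models\phi\vee\psi$ iff there are $S,S'\subseteq T$ with $S\cup S'=T$, $S\models\phi$, $S'\models\psi$; $T\models\exists p\,\phi$ iff there is $F:T\to\{\{0\},\{1\},\{0,1\}\}$ with $\{s(a/p)\mid s\in T,a\in F(s)\}\models\phi$; $T\models\forall p\,\phi$ iff $\{s(a/p)\mid s\in T,a\in\{0,1\}\}\models\phi$. Dependence atom: $T\models{=}(\bar p;q)$ iff for all $s,s'\in T$ with $s(\bar p)=s'(\bar p)$ we have $s(q)=s'(q)$. Anonymity atom: $T\models\bar p\Upsilon q$ iff for all $s\in T$ there is $s'\in T$ with $s(\bar p)=s'(\bar p)$ and $s(q)\ne s'(q)$. The arity of either atom is the length $|\bar p|\geq 0$. For $\mathcal L\in\{\mathcal{PL},\mathcal{QPL}\}$, $\mathcal L(\circledast)$ is the extension of the grammar of $\mathcal L$ with $\circledast$-atoms (not negated), and $\mathcal L(\circledast_k)_n$ is the set of $\mathcal L(\circledast)$-formulas with at most $n$ occurrences of $\circledast$-atoms, each of arity at most $k$. $\phi\equiv\psi$ means $\mathrm{FV}(\phi)=\mathrm{FV}(\psi)$ and $T\models\phi\iff T\models\psi$ for every team $T$ with $\mathrm{FV}(\phi)\subseteq\mathrm{Var}(T)$. For sets of formulas, $\mathcal L_1\le\mathcal L_2$ means every $\phi\in\mathcal L_1$ has some $\psi\in\mathcal L_2$ with $\phi\equiv\psi$. *)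

(* Defs.v *)
From mathcomp Require Import all_boot finmap.

Set Implicit Arguments.
Unset Strict Implicit.
Unset Printing Implicit Defensive.

Local Open Scope fset_scope.
Local Open Scope fmap_scope.

(* Fixing nat loses no generality: it is a countably infinite set of names. *)
Definition symbol := nat.

Inductive atom_kind := Dependence | Anonymity.

(* [Atom c ps q] is =(ps; q) for [c = Dependence] and ps Υ q for
   [c = Anonymity]; [ps] may be empty and may contain repetitions. *)
Inductive formula :=
  | Pos of symbol
  | Neg of symbol
  | And of formula & formula
  | Or of formula & formula
  | Ex of symbol & formula
  | All of symbol & formula
  | Atom of atom_kind & seq symbol & symbol.

Fixpoint FV (phi : formula) : {fset symbol} :=
  match phi with
  | Pos p | Neg p => [fset p]
  | And phi1 phi2 | Or phi1 phi2 => FV phi1 `|` FV phi2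
  | Ex p phi1 | All p phi1 => FV phi1 `\ p
  | Atom _ ps q => q |` [fset p in ps]
  end.

(* An evaluation s : V -> {0,1} on a finite set V is a finite map with domain V,
   so that s(a/p) is [s.[p <- a]], with domain [p |` V]. *)
Definition evaluation := {fmap symbol -> bool}.

Definition values (s : evaluation) (ps : seq symbol) : seq (option bool) :=
  [seq s.[? p] | p <- ps].

Definition team := {fset evaluation}.

(* Var(T) = V; the empty team is a team over every V. *)
Definition team_over (V : {fset symbol}) (T : team) : Prop :=
  forall s : evaluation, s \in T -> domf s = V.

Definition sat_atom (c : atom_kind) (T : team) (ps : seq symbol) (q : symbol) :
    Prop :=
  match c with
  | Dependence =>
      forall s s' : evaluation, s \in T -> s' \in T ->
        values s ps = values s' ps -> s.[? q] = s'.[? q]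
  | Anonymity =>
      forall s : evaluation, s \in T ->
        exists s' : evaluation,
          [/\ s' \in T, values s ps = values s' ps & s.[? q] <> s'.[? q]]
  end.

(* In the clause for [Ex], only the restriction of F to T matters, and the
   nonempty subsets of {0,1} are exactly {0}, {1} and {0,1}. *)
Fixpoint sat (T : team) (phi : formula) {struct phi} : Prop :=
  match phi with
  | Pos p => forall s : evaluation, s \in T -> s.[? p] = Some true
  | Neg p => forall s : evaluation, s \in T -> s.[? p] = Some false
  | And phi1 phi2 => sat T phi1 /\ sat T phi2
  | Or phi1 phi2 =>
      exists S S' : team,
        [/\ S `<=` T, S' `<=` T, S `|` S' = T, sat S phi1 & sat S' phi2]
  | Ex p phi1 =>
      exists F : evaluation -> {fset bool},
        (forall s : evaluation, s \in T -> F s != fset0) /\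
        sat [fset s.[p <- a] | s in T, a in F s] phi1
  | All p phi1 =>
      sat [fset s.[p <- a] | s in T, a in [fset false; true]] phi1
  | Atom c ps q => sat_atom c T ps q
  end.

Definition equivalent (phi psi : formula) : Prop :=
  FV phi = FV psi /\
  forall (V : {fset symbol}) (T : team),
    team_over V T -> FV phi `<=` V -> (sat T phi <-> sat T psi).

Inductive logic := PL | QPL.

Fixpoint quantifier_free (phi : formula) : bool :=
  match phi with
  | Pos _ | Neg _ | Atom _ _ _ => true
  | And phi1 phi2 | Or phi1 phi2 => quantifier_free phi1 && quantifier_free phi2
  | Ex _ _ | All _ _ => false
  end.

Definition in_logic (L : logic) (phi : formula) : Prop :=
  match L with
  | PL => quantifier_free phi
  | QPL => True
  end.

(* Every atom of the formula is of kind [c] and has arity at most [k]. *)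
Fixpoint atoms_in (c : atom_kind) (k : nat) (phi : formula) : Prop :=
  match phi with
  | Pos _ | Neg _ => True
  | And phi1 phi2 | Or phi1 phi2 => atoms_in c k phi1 /\ atoms_in c k phi2
  | Ex _ phi1 | All _ phi1 => atoms_in c k phi1
  | Atom c' ps _ => c' = c /\ size ps <= k
  end.

Fixpoint atom_occurrences (phi : formula) : nat :=
  match phi with
  | Pos _ | Neg _ => 0
  | And phi1 phi2 | Or phi1 phi2 =>
      atom_occurrences phi1 + atom_occurrences phi2
  | Ex _ phi1 | All _ phi1 => atom_occurrences phi1
  | Atom _ _ _ => 1
  end.

(* [lang L c k n] is the set of formulas L(c_k)_n. *)
Definition lang (L : logic) (c : atom_kind) (k n : nat) (phi : formula) : Prop :=
  [/\ in_logic L phi, atoms_in c k phi & atom_occurrences phi <= n].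

Definition expressible_in (L1 L2 : formula -> Prop) : Prop :=
  forall phi, L1 phi -> exists psi, L2 psi /\ equivalent phi psi.

(* Main.v *)
(** An atom whose first condition symbol is [p] holds in a team iff the atom
    without [p] holds both in the half with [p] true and in the half with [p]
    false; this gives (i), and (iii) by iteration. By (iii), (ii) follows from
    (iv).

    For (iv), fix the domain [V] and call a family of teams a cell if it is
    convex under inclusion and, when nonempty, has a greatest team. The
    connectives and quantifiers preserve cells, literals define one cell and
    nullary atoms a union of two, so a formula with [m] nullary atoms defines a
    union of [2 ^ m] cells. On the other hand [n] atoms of arity [k], guarded by
    mutually exclusive conditions, behave like a single atom with [n * 2 ^ k]
    possible keys; they are satisfied by a family of teams indexed by the subsets
    of the keys, no two of which lie in a common cell. *)

Require Import Defs.
From mathcomp Require Import all_boot finmap.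

Set Implicit Arguments.
Unset Strict Implicit.
Unset Printing Implicit Defensive.

Local Open Scope fset_scope.
Local Open Scope fmap_scope.
Local Open Scope nat_scope.

(** * Atoms relative to an arbitrary key *)

Definition keyed_atom (c : atom_kind) (K : Type) (key : evaluation -> K)
    (q : symbol) (T : team) : Prop :=
  match c with
  | Dependence =>
      forall s s' : evaluation, s \in T -> s' \in T ->
        key s = key s' -> s.[? q] = s'.[? q]
  | Anonymity =>
      forall s : evaluation, s \in T ->
        exists s' : evaluation,
          [/\ s' \in T, key s = key s' & s.[? q] <> s'.[? q]]
  end.

Lemma sat_atomE c T ps q :
  sat_atom c T ps q = keyed_atom c (fun s => values s ps) q T.
Proof. by case: c. Qed.

Lemma eq_keyed_atom c K K' (key : evaluation -> K) (key' : evaluation -> K') q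
    (T : team) :
  (forall s s', s \in T -> s' \in T -> key s = key s' <-> key' s = key' s') ->
  keyed_atom c key q T <-> keyed_atom c key' q T.
Proof.
move=> eqk; case: c => /=; split.
- by move=> dep s s' sT s'T /(eqk _ _ sT s'T); apply: dep.
- by move=> dep s s' sT s'T /(eqk _ _ sT s'T); apply: dep.
- move=> anon s sT; have [s' [s'T /(eqk _ _ sT s'T) ? ?]] := anon s sT.
  by exists s'.
- move=> anon s sT; have [s' [s'T /(eqk _ _ sT s'T) ? ?]] := anon s sT.
  by exists s'.
Qed.

(** Equal keys force equal values of [P], so the pairs compared by dependence and the witnesses of
    anonymity never cross between the halves. Inside a half only the kernel of the key matters, so
    each half may use a key of another type: bare values on one side, an index with values on the
    other. *)
Lemma keyed_atom_split c K K1 K0 (key : evaluation -> K)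
    (key1 : evaluation -> K1) (key0 : evaluation -> K0) q
    (P : pred evaluation) (T : team) :
  (forall s s', s \in T -> s' \in T -> key s = key s' -> P s = P s') ->
  (forall s s', s \in T -> s' \in T -> P s -> P s' ->
     key s = key s' <-> key1 s = key1 s') ->
  (forall s s', s \in T -> s' \in T -> ~~ P s -> ~~ P s' ->
     key s = key s' <-> key0 s = key0 s') ->
  keyed_atom c key q T <->
  keyed_atom c key1 q [fset s in T | P s] /\
  keyed_atom c key0 q [fset s in T | ~~ P s].
Proof.
move=> keyP eq1 eq0.
have -> : keyed_atom c key1 q [fset s in T | P s] <->
          keyed_atom c key q [fset s in T | P s].
  apply: eq_keyed_atom => s s'; rewrite !inE /= => /andP[sT Ps] /andP[s'T Ps'].
  by apply: iff_sym; apply: eq1.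
have -> : keyed_atom c key0 q [fset s in T | ~~ P s] <->
          keyed_atom c key q [fset s in T | ~~ P s].
  apply: eq_keyed_atom => s s'; rewrite !inE /= => /andP[sT Ps] /andP[s'T Ps'].
  by apply: iff_sym; apply: eq0.
clear eq1 eq0.
case: c => /=; split.
- move=> dep; split=> s s'; rewrite !inE /= => /andP[sT _] /andP[s'T _];
    exact: dep.
- move=> [depP depN] s s' sT s'T eq_key.
  have eqP := keyP _ _ sT s'T eq_key.
  by case Ps: (P s) eqP => eqP; [apply: depP|apply: depN];
    rewrite ?inE /= ?sT ?s'T ?Ps -?eqP.
- move=> anon; split=> s; rewrite !inE /= => /andP[sT Ps];
    have [s' [s'T eq_key neq_q]] := anon s sT; exists s'; split=> //;
    by rewrite !inE /= s'T -(keyP s).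
- move=> [anonP anonN] s sT; case Ps: (P s).
    have [|s' []] := anonP s; first by rewrite !inE /= sT.
    by rewrite !inE /= => /andP[s'T _] ? ?; exists s'.
  have [|s' []] := anonN s; first by rewrite !inE /= sT Ps.
  by rewrite !inE /= => /andP[s'T _] ? ?; exists s'.
Qed.

(** * Domains of subteams and supplemented teams *)

Lemma team_overS V (S T : team) : team_over V T -> S `<=` T -> team_over V S.
Proof. by move=> TV /fsubsetP ST s /ST /TV. Qed.

Lemma supplementP (p : symbol) (T : team) (F : evaluation -> {fset bool})
    (t : evaluation) :
  reflect (exists s a, [/\ s \in T, a \in F s & t = s.[p <- a]])
    (t \in [fset s.[p <- a] | s in T, a in F s]).
Proof.
apply: (iffP (imfset2P _ _ _ _ _)).
  by move=> [s sT [a aF ->]]; exists s, a.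
by move=> [s [a [sT aF ->]]]; exists s => //; exists a.
Qed.

Lemma team_over_supplement V T (p : symbol) (F : evaluation -> {fset bool}) :
  team_over V T ->
  team_over (p |` V) [fset s.[p <- a] | s in T, a in F s].
Proof.
by move=> TV t /supplementP[s [a [sT _ ->]]]; rewrite dom_setf TV.
Qed.

Lemma fnd_total (V : {fset symbol}) (s : evaluation) p :
  domf s = V -> p \in V -> exists b, s.[? p] = Some b.
Proof.
by move=> <- ps; exists s.[ps]; rewrite in_fnd.
Qed.

(** * Case distinction on a symbol and arity reduction *)

Definition branch (r : symbol) (phi psi : formula) : formula :=
  Or (And (Pos r) phi) (And (Neg r) psi).

(** The literals on [r] leave only one admissible splitting of [T], so the existential in the
    disjunction disappears. *)
Lemma sat_branch V T r phi psi : team_over V T -> r \in V ->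
  sat T (branch r phi psi) <->
  sat [fset s in T | s.[? r] == Some true] phi /\
  sat [fset s in T | s.[? r] != Some true] psi.
Proof.
move=> TV rV; split=> /=.
  move=> [S [S' [ST S'T defT [rS satS] [rS' satS']]]].
  suff [-> ->] : [fset s in T | s.[? r] == Some true] = S /\
                 [fset s in T | s.[? r] != Some true] = S' by [].
  split; apply/fsetP=> s; rewrite !inE /= -defT inE.
    case sS: (s \in S); first by rewrite rS.
    by case sS': (s \in S') => //=; rewrite rS'.
  case sS': (s \in S'); first by rewrite rS' // orbT.
  by case sS: (s \in S) => //=; rewrite rS.
move=> [sat1 sat0].
exists [fset s in T | s.[? r] == Some true],
       [fset s in T | s.[? r] != Some true]; split.
- by apply/fsubsetP=> s; rewrite !inE /= => /andP[].
- by apply/fsubsetP=> s; rewrite !inE /= => /andP[].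
- by apply/fsetP=> s; rewrite !inE /= -andb_orr orbN andbT.
- by split=> // s; rewrite !inE /= => /andP[_ /eqP].
- split=> // s; rewrite !inE /= => /andP[sT].
  by have [[] ->] := fnd_total (TV s sT) rV.
Qed.

Fixpoint lower_arity (phi : formula) : formula :=
  match phi with
  | And phi1 phi2 => And (lower_arity phi1) (lower_arity phi2)
  | Or phi1 phi2 => Or (lower_arity phi1) (lower_arity phi2)
  | Ex p phi1 => Ex p (lower_arity phi1)
  | All p phi1 => All p (lower_arity phi1)
  | Atom c (p :: ps) q => branch p (Atom c ps q) (Atom c ps q)
  | _ => phi
  end.

Lemma FV_lower_arity phi : FV (lower_arity phi) = FV phi.
Proof.
elim: phi => //= [phi1 -> phi2 ->|phi1 -> phi2 ->|p phi1 ->|p phi1 ->|] //.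
move=> c [|p ps] q //=; apply/fsetP=> x; rewrite !inE /=.
by case: (x == p); case: (x == q); case: (x \in ps).
Qed.

Lemma sat_branch_atom V T c p ps q : team_over V T -> p \in V ->
  sat_atom c T (p :: ps) q <-> sat T (branch p (Atom c ps q) (Atom c ps q)).
Proof.
move=> TV pV; apply: iff_trans (iff_sym (sat_branch _ _ TV pV)).
rewrite /= !sat_atomE; apply: keyed_atom_split => s s' sT s'T.
- by move=> [->].
- by move=> /eqP sp /eqP s'p; rewrite /= sp s'p; split=> [[]|->].
- have [[] sp] := fnd_total (TV s sT) pV; rewrite /= sp // => _.
  have [[] s'p] := fnd_total (TV s' s'T) pV; rewrite s'p // => _.
  by split=> [[]|->].
Qed.

Lemma fsubD1U (A V : {fset symbol}) p : A `\ p `<=` V -> A `<=` p |` V.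
Proof. by rewrite fsubDset. Qed.

(** The induction generalises [V] because a quantifier on [p] moves to teams over [V] extended by
    [p]. *)
Lemma sat_lower_arity phi V T : team_over V T -> FV phi `<=` V ->
  sat T phi <-> sat T (lower_arity phi).
Proof.
elim: phi V T => //=.
- move=> phi1 IH1 phi2 IH2 V T TV; rewrite fsubUset => /andP[V1 V2].
  by rewrite (IH1 _ _ TV V1) (IH2 _ _ TV V2).
- move=> phi1 IH1 phi2 IH2 V T TV; rewrite fsubUset => /andP[V1 V2].
  split=> -[S [S' [ST S'T defT sat1 sat2]]]; exists S, S'; split=> //.
  + exact/(IH1 _ _ (team_overS TV ST) V1).
  + exact/(IH2 _ _ (team_overS TV S'T) V2).
  + exact/(IH1 _ _ (team_overS TV ST) V1).
  + exact/(IH2 _ _ (team_overS TV S'T) V2).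
- move=> p phi IH V T TV /fsubD1U pV.
  split=> -[F [F0 satF]]; exists F; split=> //.
  + exact/(IH _ _ (team_over_supplement TV) pV).
  + exact/(IH _ _ (team_over_supplement TV) pV).
- move=> p phi IH V T TV /fsubD1U pV.
  exact: (IH _ _ (team_over_supplement TV) pV).
- move=> c [|p ps] q V T TV //; rewrite fsubUset => /andP[_ /fsubsetP psV].
  by apply: sat_branch_atom TV _; apply: psV; rewrite !inE /= eqxx.
Qed.

Lemma lang_lower_arity L c k n phi :
  lang L c k.+1 n phi -> lang L c k (2 * n) (lower_arity phi).
Proof.
move=> [inL at_k occ_n]; split.
- case: L inL => //=; elim: phi {at_k occ_n} => //=.
  + by move=> phi1 IH1 phi2 IH2 /andP[/IH1-> /IH2->].
  + by move=> phi1 IH1 phi2 IH2 /andP[/IH1-> /IH2->].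
  + by move=> c' [].
- elim: phi at_k {inL occ_n} => //=.
  + by move=> phi1 IH1 phi2 IH2 [/IH1 ? /IH2 ?].
  + by move=> phi1 IH1 phi2 IH2 [/IH1 ? /IH2 ?].
  + by move=> c' [|p ps] q [-> ?].
- apply: leq_trans (leq_mul (leqnn 2) occ_n).
  elim: phi {inL at_k occ_n} => //=.
  + by move=> phi1 IH1 phi2 IH2; rewrite mulnDr leq_add.
  + by move=> phi1 IH1 phi2 IH2; rewrite mulnDr leq_add.
  + by move=> c' [].
Qed.

Lemma equivalent_trans phi psi chi :
  equivalent phi psi -> equivalent psi chi -> equivalent phi chi.
Proof.
move=> [eqFV1 eqs1] [eqFV2 eqs2]; split; first by rewrite eqFV1.
move=> V T TV phiV; rewrite (eqs1 V T TV phiV); apply: (eqs2 V T TV).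
by rewrite -eqFV1.
Qed.

Lemma expressible_in_trans L1 L2 L3 :
  expressible_in L1 L2 -> expressible_in L2 L3 -> expressible_in L1 L3.
Proof.
move=> le12 le23 phi /le12[psi [/le23[chi [L3chi eq2]] eq1]].
by exists chi; split=> //; apply: equivalent_trans eq1 eq2.
Qed.

Lemma expressible_lower_arity L c k n :
  expressible_in (lang L c k.+1 n) (lang L c k (2 * n)).
Proof.
move=> phi Lphi; exists (lower_arity phi); split; first exact: lang_lower_arity.
split=> [|V T]; [by rewrite FV_lower_arity|exact: sat_lower_arity].
Qed.

Lemma expressible_nullary L c k n :
  expressible_in (lang L c k n) (lang L c 0 (n * 2 ^ k)).
Proof.
elim: k n => [|k IHk] n.
  by move=> phi Lphi; exists phi; rewrite muln1.
rewrite expnS mulnA (mulnC n).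
exact: expressible_in_trans (@expressible_lower_arity _ _ _ _) (IHk _).
Qed.

(** * Cells and their closure properties *)

(* The two clauses make [D] convex. Taking [W] to be a
   predicate instead of a team of the family admits the empty family, to which an
   intersection of cells may reduce, and avoids enumerating evaluations. *)
Definition cell (D : team -> Prop) : Prop :=
  exists W : pred evaluation,
    (forall T s, D T -> s \in T -> W s) /\
    (forall S T : team, D S -> S `<=` T -> (forall s, s \in T -> W s) -> D T).

Lemma cell_flat (P : pred evaluation) :
  cell (fun T => forall s, s \in T -> P s).
Proof. by exists P; split=> // T s; apply. Qed.

Lemma cell_and D E : cell D -> cell E -> cell (fun T => D T /\ E T).
Proof.
move=> [W [DW closD]] [X [EX closE]]; exists (fun s => W s && X s); split.
  by move=> T s [DT ET] sT; rewrite (DW T) ?(EX T).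
move=> S T [DS ES] ST TW.
by split; [apply: (closD S)|apply: (closE S)] => // s /TW /andP[].
Qed.

Lemma cell_or D E : cell D -> cell E ->
  cell (fun T => exists S S' : team,
    [/\ S `<=` T, S' `<=` T, S `|` S' = T, D S & E S']).
Proof.
move=> [W [DW closD]] [X [EX closE]]; exists (fun s => W s || X s); split.
  move=> T s [S [S' [_ _ <- DS ES']]]; rewrite inE.
  by case/orP=> [/(DW _ _ DS)->|/(EX _ _ ES')->] //; rewrite orbT.
move=> R T [S [S' [_ _ <- DS ES']]] RT TW; move: RT.
rewrite fsubUset => /andP[ST S'T].
(* Each part absorbs every evaluation of [T] that its own bound permits; together they exhaust [T],
   since each member satisfies [W] or [X]. *)
exists (S `|` [fset s in T | W s]), (S' `|` [fset s in T | X s]); split.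
- rewrite fsubUset ST; apply/fsubsetP=> s; by rewrite !inE => /andP[].
- rewrite fsubUset S'T; apply/fsubsetP=> s; by rewrite !inE => /andP[].
- apply/fsetP=> s; rewrite !inE /=.
  case sT: (s \in T) => /=.
    by case/orP: (TW s sT) => ->; rewrite !orbT.
  rewrite !orbF; apply/negbTE; rewrite negb_or.
  by rewrite (contraFN (fsubsetP ST s)) ?(contraFN (fsubsetP S'T s)).
- apply: (closD S) => //; first exact: fsubsetUl.
  by move=> s; rewrite !inE => /orP[/(DW _ _ DS)|/andP[]].
- apply: (closE S') => //; first exact: fsubsetUl.
  by move=> s; rewrite !inE => /orP[/(EX _ _ ES')|/andP[]].
Qed.

Lemma cell_ex (p : symbol) D : cell D ->
  cell (fun T => exists F : evaluation -> {fset bool},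
    (forall s : evaluation, s \in T -> F s != fset0) /\
    D [fset s.[p <- a] | s in T, a in F s]).
Proof.
move=> [W [DW closD]].
exists (fun s => W s.[p <- false] || W s.[p <- true]); split.
  move=> T s [F [F0 DTF]] sT; have /fset0Pn[a aF] := F0 s sT.
  have: W s.[p <- a] by apply: DW DTF _; apply/supplementP; exists s, a.
  by case: a {aF} => ->; rewrite ?orbT.
move=> S T [F [F0 DSF]] ST TW.
(* The old choices are kept on [S], so that the supplement of [S] stays included; a new evaluation
   receives every value that [W] permits, and there is at least one. *)
pose G s := if s \in S then F s
            else [fset a in [fset false; true] | W s.[p <- a]].
exists G; split=> [s sT|].
  rewrite /G; case: ifP => [/F0 //|_]; apply/fset0Pn.
  by case/orP: (TW s sT) => Wa; [exists false|exists true]; rewrite !inE.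
apply: (closD _ _ DSF).
  apply/fsubsetP=> _ /supplementP[s [a [sS aF ->]]]; apply/supplementP.
  by exists s, a; split=> //; [exact: (fsubsetP ST)|rewrite /G sS].
move=> _ /supplementP[s [a [sT aG ->]]]; move: aG; rewrite /G.
case: ifP => [sS aF|_]; last by rewrite !inE => /andP[].
by apply: DW DSF _; apply/supplementP; exists s, a.
Qed.

Lemma cell_all (p : symbol) D : cell D ->
  cell (fun T => D [fset s.[p <- a] | s in T, a in [fset false; true]]).
Proof.
move=> [W [DW closD]].
exists (fun s => W s.[p <- false] && W s.[p <- true]); split.
  move=> T s DT sT.
  have Wa a : W s.[p <- a].
    by apply: DW DT _; apply/supplementP; exists s, a; rewrite sT; case: a;
      rewrite !inE.
  by rewrite !Wa.
move=> S T DS ST TW; apply: (closD _ _ DS).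
  apply/fsubsetP=> _ /supplementP[s [a [sS aF ->]]]; apply/supplementP.
  by exists s, a; split=> //; exact: (fsubsetP ST).
by move=> _ /supplementP[s [[] [/TW/andP[? ?] _ ->]]].
Qed.

(** * Formulas with nullary atoms as unions of cells *)

Definition cell_union (V : {fset symbol}) (P : team -> Prop) (N : nat) : Prop :=
  exists (I : finType) (C : I -> team -> Prop),
    [/\ #|I| = N, forall i, cell (C i)
      & forall T, team_over V T -> P T <-> exists i, C i T].

Lemma cell_union_flat V (P : pred evaluation) :
  cell_union V (fun T => forall s, s \in T -> P s) 1.
Proof.
exists unit, (fun _ T => forall s, s \in T -> P s).
split=> [|_|T _]; [exact: card_unit|exact: cell_flat|].
by split=> [PT|[_ //]]; exists tt.
Qed.

Lemma eq_cell_union V P Q N : (forall T, team_over V T -> P T <-> Q T) ->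
  cell_union V P N -> cell_union V Q N.
Proof.
move=> PQ [I [C [cardI cellC PC]]]; exists I, C; split=> // T TV.
by rewrite -(PQ T TV) (PC T TV).
Qed.

(** For dependence the two cells are the teams on which [q] is constantly true or constantly false.
    For anonymity they are the teams where [q] takes two values, a family closed under supersets,
    and the family containing only the empty team. *)
Lemma cell_union_nullary V c q : q \in V ->
  cell_union V (fun T => sat_atom c T [::] q) 2.
Proof.
move=> qV; case: c.
  exists bool, (fun b (T : team) =>
    forall s : evaluation, s \in T -> s.[? q] == Some b).
  split=> [|b|T TV]; [exact: card_bool|exact: cell_flat|].
  split=> [dep|[b Tb] s s' /Tb/eqP-> /Tb/eqP-> //].
  have [->|[s sT]] := fset_0Vmem T; first by exists true.
  have [b sb] := fnd_total (TV s sT) qV.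
  by exists b => s' s'T; rewrite -sb; apply/eqP/dep.
exists bool, (fun b (T : team) => if b then exists s s' : evaluation,
    [/\ s \in T, s' \in T & s.[? q] <> s'.[? q]]
  else forall s : evaluation, s \in T -> false).
split=> [|[]|T TV]; [exact: card_bool| |exact: cell_flat (fun=> false)|].
  exists predT; split=> // S T [s [s' [sS s'S neq]]] /fsubsetP ST _.
  by exists s, s'; split=> //; apply: ST.
split=> /= [anon|[[[s [s' [sT s'T neq]]] t tT|T0 s /T0 //]]].
  have [->|[s sT]] := fset_0Vmem T; first by exists false => s.
  by have [s' [s'T _ neq]] := anon s sT; exists true, s, s'.
case: (eqVneq t.[? q] s.[? q]) => [->|/eqP ne]; first by exists s'.
by exists s.
Qed.

(** Both binary connectives distribute over unions, so their cells are indexed by pairs and the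
    counts multiply; quantifiers keep the index type. *)
Lemma cell_union_nullary_formula c phi V : atoms_in c 0 phi -> FV phi `<=` V ->
  cell_union V (fun T => sat T phi) (2 ^ atom_occurrences phi).
Proof.
elim: phi V => /=.
- move=> p V _ _; have := cell_union_flat V (fun s => s.[? p] == Some true).
  by apply: eq_cell_union => T _; split=> H s /H /eqP.
- move=> p V _ _; have := cell_union_flat V (fun s => s.[? p] == Some false).
  by apply: eq_cell_union => T _; split=> H s /H /eqP.
- move=> phi1 IH1 phi2 IH2 V [at1 at2]; rewrite fsubUset => /andP[V1 V2].
  have [I [C [cardI cellC satC]]] := IH1 V at1 V1.
  have [J [E [cardJ cellE satE]]] := IH2 V at2 V2.
  exists (I * J)%type, (fun ij T => C ij.1 T /\ E ij.2 T).
  split=> [|ij|T TV]; [by rewrite card_prod cardI cardJ expnD|exact: cell_and|].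
  rewrite (satC T TV) (satE T TV).
  split=> [[[i Ci] [j Ej]]|[[i j] [Ci Ej]]].
    by exists (i, j).
  by split; [exists i|exists j].
- move=> phi1 IH1 phi2 IH2 V [at1 at2]; rewrite fsubUset => /andP[V1 V2].
  have [I [C [cardI cellC satC]]] := IH1 V at1 V1.
  have [J [E [cardJ cellE satE]]] := IH2 V at2 V2.
  exists (I * J)%type, (fun ij T => exists S S' : team,
    [/\ S `<=` T, S' `<=` T, S `|` S' = T, C ij.1 S & E ij.2 S']).
  split=> [|ij|T TV]; [by rewrite card_prod cardI cardJ expnD|exact: cell_or|].
  split=> [[S [S' [ST S'T defT]]]|[[i j] [S [S' [ST S'T defT Ci Ej]]]]].
    rewrite (satC S (team_overS TV ST)) (satE S' (team_overS TV S'T)).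
    by move=> [i Ci] [j Ej]; exists (i, j), S, S'.
  exists S, S'; split=> //.
    by apply/(satC S (team_overS TV ST)); exists i.
  by apply/(satE S' (team_overS TV S'T)); exists j.
- move=> p phi IH V atm /fsubD1U pV.
  have [I [C [cardI cellC satC]]] := IH _ atm pV.
  exists I, (fun i T => exists F : evaluation -> {fset bool},
    (forall s : evaluation, s \in T -> F s != fset0) /\
    C i [fset s.[p <- a] | s in T, a in F s]).
  split=> [|i|T TV]; [by []|exact: cell_ex|].
  split=> [[F [F0]]|[i [F [F0 Ci]]]].
    by rewrite (satC _ (team_over_supplement TV)) => -[i Ci]; exists i, F.
  exists F; split=> //; apply/(satC _ (team_over_supplement TV)); by exists i.
- move=> p phi IH V atm /fsubD1U pV.
  have [I [C [cardI cellC satC]]] := IH _ atm pV.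
  exists I, (fun i T =>
    C i [fset s.[p <- a] | s in T, a in [fset false; true]]).
  split=> [|i|T TV]; [by []|exact: cell_all|].
  exact: satC (team_over_supplement TV).
- move=> c' [|p ps] q V [_ //] _; rewrite fsubUset => /andP[/fsubsetP qV _].
  by apply: cell_union_nullary; apply: qV; rewrite inE.
Qed.

(** * A fooling family of teams for a keyed atom *)

Section FoolingFamily.

Variables (c : atom_kind) (V : {fset symbol}) (K : Type).
Variables (key : evaluation -> K) (q : symbol).
Variables (Z : finType) (e : Z -> bool -> evaluation).
Hypothesis dom_e : forall z b, domf (e z b) = V.
Hypothesis key_inj : forall z z' b b', key (e z b) = key (e z' b') -> z = z'.
Hypothesis key_e : forall z b b', key (e z b) = key (e z b').
Hypothesis fnd_e : forall z b, (e z b).[? q] = Some b.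

(* [X] is read as a map from keys to bits for dependence, and as the set of keys
   at which both bits occur for anonymity. *)
Definition fooling_mem (X : Z -> bool) (zb : Z * bool) : bool :=
  match c with
  | Dependence => zb.2 == X zb.1
  | Anonymity => X zb.1
  end.

Definition fooling_team (X : Z -> bool) : team :=
  [fset e zb.1 zb.2 | zb in [pred zb : Z * bool | fooling_mem X zb]].

Lemma fooling_teamP X s :
  reflect (exists z b, s = e z b /\ fooling_mem X (z, b))
    (s \in fooling_team X).
Proof.
apply: (iffP (imfsetP _ _ _ _)) => /=.
  by move=> [[z b] /= Xzb ->]; exists z, b.
by move=> [z [b [-> Xzb]]]; exists (z, b).
Qed.

Lemma team_over_fooling X : team_over V (fooling_team X).
Proof. by move=> s /fooling_teamP[z [b [-> _]]]. Qed.

Lemma keyed_atom_fooling X : keyed_atom c key q (fooling_team X).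
Proof.
have inX z b : fooling_mem X (z, b) -> e z b \in fooling_team X.
  by move=> Xzb; apply/fooling_teamP; exists z, b.
move: inX (@fooling_teamP X); rewrite /fooling_mem; case: c => /= inX memX.
  move=> s s' /memX[z [b [-> /eqP->]]] /memX[z' [b' [-> /eqP->]]].
  by move=> /key_inj ->; rewrite !fnd_e.
move=> s /memX[z [b [-> Xz]]]; exists (e z (~~ b)).
by split; [exact: inX|exact: key_e|rewrite !fnd_e; case: b].
Qed.

(** Adding [e z true] to the team of [X] stays inside the cell, because this evaluation occurs in
    the team of [Y]. It breaks the atom: for dependence it clashes with [e z false], and for
    anonymity it is the only evaluation with its key. *)
Lemma fooling_cell (X Y : Z -> bool) z D :
  cell D -> X z = false -> Y z = true ->
  D (fooling_team X) -> D (fooling_team Y) ->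
  exists2 T, team_over V T & D T /\ ~ keyed_atom c key q T.
Proof.
move=> [W [DW closD]] Xz Yz DX DY; exists (e z true |` fooling_team X).
  move=> s; rewrite inE => /orP[|/team_over_fooling //].
  by rewrite inE => /eqP->; exact: dom_e.
split.
  apply: (closD _ _ DX); first exact: fsubsetUr.
  move=> s; rewrite inE => /orP[|/(DW _ _ DX) //]; rewrite inE => /eqP->.
  apply: DW DY _; apply/fooling_teamP; exists z, true; split=> //.
  by rewrite /fooling_mem /= Yz; case: c.
have zT : e z true \in e z true |` fooling_team X by rewrite !inE eqxx.
move: zT (@fooling_teamP X); rewrite /fooling_mem; case: c => /= zT memX.
  move=> /(_ (e z true) (e z false) zT); rewrite !fnd_e => dep.
  suff : Some true = Some false by [].
  apply: dep; last exact: key_e.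
  by rewrite inE; apply/orP; right; apply/memX; exists z, false; rewrite Xz.
move=> /(_ _ zT)[s' [s'T eq_key neq]]; move: s'T eq_key neq.
rewrite inE => /orP[|/memX[z' [b [-> Xz']]]]; first by rewrite inE => /eqP->.
by move=> /key_inj eqz; rewrite -eqz Xz in Xz'.
Qed.

(** Choosing for each [X] a cell that contains its team is injective, since a cell shared by two
    maps would contain a team that violates the atom. *)
Lemma fooling_bound P N :
  (forall T, team_over V T -> P T <-> keyed_atom c key q T) ->
  cell_union V P N -> 2 ^ #|Z| <= N.
Proof.
move=> Pkey [I [C [<- cellC PC]]].
have /fin_all_exists[f Cf] (X : {ffun Z -> bool}) :
    exists i, C i (fooling_team X).
  have XV := @team_over_fooling X.
  by apply/(PC _ XV)/(Pkey _ XV)/keyed_atom_fooling.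
have -> : 2 ^ #|Z| = #|{ffun Z -> bool}| by rewrite card_ffun card_bool.
apply: (leq_card f) => X Y eqf; apply/ffunP=> z; apply/eqP/negPn/negP => neqz.
have cD := cellC (f X); have CX := Cf X; have CY := Cf Y.
rewrite -eqf in CY.
have [T TV [DT]] :
    exists2 T, team_over V T & C (f X) T /\ ~ keyed_atom c key q T.
  (* Whichever map is false at [z] supplies the smaller team to be enlarged. *)
  move: neqz; case Xz: (X z); case Yz: (Y z) => // _.
    exact: fooling_cell cD Yz Xz CY CX.
  exact: fooling_cell cD Xz Yz CX CY.
by case; apply/(Pkey T TV)/(PC T TV); exists (f X).
Qed.

End FoolingFamily.

(** * Guarded atoms that reach the lower bound *)

(* The symbols below [k] are the condition of every atom, [k] is its target, and
   [k + 1], ..., [k + n] are the guards: the largest true one selects the atom. *)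
Fixpoint indexed_atoms (c : atom_kind) (k n : nat) : formula :=
  match n with
  | 0 => Atom c (iota 0 k) k
  | n'.+1 => branch (k + n) (Atom c (iota 0 k) k) (indexed_atoms c k n')
  end.

(** Index 0 means that no guard is true and selects the innermost atom, so [n] guards distinguish
    [n.+1] atoms. *)
Fixpoint index_of (k n : nat) (s : evaluation) : nat :=
  match n with
  | 0 => 0
  | n'.+1 => if s.[? k + n] == Some true then n else index_of k n' s
  end.

Lemma index_of_le k n s : index_of k n s <= n.
Proof. by elim: n => //= n IHn; case: ifP => // _; apply: leqW. Qed.

Lemma sat_indexed_atoms c k n V T :
  team_over V T -> FV (indexed_atoms c k n) `<=` V ->
  sat T (indexed_atoms c k n) <->
  keyed_atom c (fun s => (index_of k n s, values s (iota 0 k))) k T.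
Proof.
elim: n T => [|n IHn] T TV.
  rewrite /= sat_atomE => _; apply: eq_keyed_atom => s s' _ _.
  by split=> [->|[]].
rewrite [FV _]/= !fsubUset => /andP[/andP[rV _] /andP[_ nV]].
have {}rV : k + n.+1 \in V by apply: (fsubsetP rV); rewrite inE.
apply: iff_trans (sat_branch _ _ TV rV) _.
(* Index [n.+1] can only come from the outermost guard, so equal keys put two evaluations in the
   same branch. *)
have N1 (s : evaluation) : index_of k n s <> n.+1.
  by move=> eqn; have := index_of_le k n s; rewrite eqn ltnn.
have TV0 : team_over V [fset s in T | s.[? k + n.+1] != Some true].
  by apply: team_overS TV _; apply/fsubsetP=> s; rewrite !inE => /andP[].
rewrite (IHn _ TV0 nV) /= sat_atomE; apply: iff_sym.
apply: keyed_atom_split => s s' _ _.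
- by case=> + _; do 2![case: ifP => //] => _ _ => [/esym/N1|/N1].
- by move=> -> ->; split=> [[]|->].
- by move=> /negbTE-> /negbTE->.
Qed.

Lemma lang_indexed_atoms L c k n :
  lang L c k n.+1 (indexed_atoms c k n).
Proof.
split; last by elim: n => //= n; rewrite !add0n add1n ltnS.
- by case: L => //=; elim: n.
- by elim: n => /= [|n IHn]; rewrite size_iota.
Qed.

Definition evaluation_of (V : {fset symbol}) (h : symbol -> bool) :
    evaluation :=
  [fmap p : V => h (val p)].

Lemma fnd_evaluation_of V h p :
  p \in V -> (evaluation_of V h).[? p] = Some (h p).
Proof. by move=> pV; rewrite in_fnd ffunE. Qed.

(** A key is one of [n.+1] indices together with [k] bits, and every such key is realised with both
    values of the target, so the fooling bound applies to all [n.+1 * 2 ^ k] keys. *)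
Lemma indexed_atoms_bound c k n N :
  let phi := indexed_atoms c k n in
  cell_union (FV phi) (fun T => sat T phi) N -> 2 ^ (n.+1 * 2 ^ k) <= N.
Proof.
move=> phi cells; set V := FV phi in cells.
have [psV qV rV] : [/\ {subset iota 0 k <= V}, k \in V
    & forall i, 0 < i <= n -> k + i \in V].
  rewrite /V /phi {V phi cells}; elim: n => [|n [psV qV rV]] /=.
    split=> [p pps||[]//]; first by rewrite !inE pps orbT.
    by rewrite !inE eqxx.
  split=> [p /psV pV|| i]; first by rewrite !inE pV !orbT.
    by rewrite !inE qV !orbT.
  rewrite (leq_eqVlt i) => /andP[i0 /orP[/eqP->|lein]].
    by rewrite !inE eqxx.
  by rewrite !inE rV ?orbT // i0.
pose Z := ('I_n.+1 * k.-tuple bool)%type.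
(* The target gets [b], the condition symbols get the bits of the tuple, and only the guard numbered
   [z.1] is true. For [z.1 = 0] the last test would hit [k], which the first test has already
   caught, so all guards are false. *)
pose h (z : Z) b p :=
  if p == k then b else if p < k then nth false z.2 p else p == k + z.1.
pose e z b := evaluation_of V (h z b).
have idx_e z b : index_of k n (e z b) = z.1.
  have le_z : z.1 <= n by rewrite -ltnS.
  have {}rV i : 0 < i <= n -> (e z b).[? k + i] = Some (i == z.1 :> nat).
    move=> /[dup] /rV kiV /andP[i0 _]; rewrite /e fnd_evaluation_of // /h.
    rewrite -{2}[k]addn0 !eqn_add2l eqn0Ngt i0 /=.
    by rewrite ltnNge leq_addr.
  (* The evaluation is abstracted so that the induction runs only over the number of guards
     inspected. *)
  move: (e z b) (nat_of_ord z.1) le_z rV => s l.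
  elim: (n) => [|j IHj] /=; first by rewrite leqn0 => /eqP->.
  rewrite leq_eqVlt => /orP[/eqP->|lt_zj] rV.
    by rewrite rV ?leqnn // eqxx.
  rewrite rV ?leqnn // (gtn_eqF lt_zj) IHj // => i /andP[i0 lt_ij].
  by rewrite rV // i0 leqW.
have val_e z b : values (e z b) (iota 0 k) = [seq Some a | a <- z.2].
  apply: (@eq_from_nth _ None); first by rewrite !size_map size_iota size_tuple.
  move=> i; rewrite size_map size_iota => lt_ik.
  rewrite (nth_map 0) ?size_iota // nth_iota // add0n.
  rewrite fnd_evaluation_of; last by rewrite psV // mem_iota.
  by rewrite /h ltn_eqF // lt_ik (nth_map false) ?size_tuple.
have -> : n.+1 * 2 ^ k = #|Z : finType|.
  by rewrite card_prod card_ord card_tuple card_bool.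
apply: (@fooling_bound c V _
  (fun s => (index_of k n s, values s (iota 0 k))) k Z e _ _ _ _ _ N _ cells).
- by [].
- move=> [i a] [i' a'] b b' []; rewrite !idx_e !val_e => /val_inj /= ->.
  by move=> /inj_map /val_inj -> // ? ? [].
- by move=> z b b'; rewrite !idx_e !val_e.
- by move=> z b; rewrite fnd_evaluation_of // /h eqxx.
- by move=> T TV; apply: sat_indexed_atoms TV _.
Qed.

(** * Inexpressibility and the hierarchy *)

Lemma not_expressible_nullary L c k n m : m < n * 2 ^ k ->
  ~ expressible_in (lang L c k n) (lang L c 0 m).
Proof.
case: n => // n lt_m /(_ _ (lang_indexed_atoms L c k n)).
move=> [psi [[_ atoms_psi occ_psi] [eqFV eq_sat]]].
have := cell_union_nullary_formula atoms_psi (fsubset_refl (FV psi)).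
(* Equality of the free symbols lets both formulas be compared on teams whose domain is exactly this
   set. *)
rewrite -eqFV => /(eq_cell_union _) cells.
have {cells} /indexed_atoms_bound := cells _ (fun T TV =>
  iff_sym (eq_sat _ T TV (fsubset_refl _))).
by rewrite leq_exp2l // leqNgt (leq_ltn_trans occ_psi).
Qed.

Theorem theorem5p2 (L : logic) (c : atom_kind) (k : nat) :
  [/\ (forall n : nat,
         expressible_in (lang L c k.+1 n) (lang L c k (2 * n))),
      (forall n m : nat, 0 < n -> n <= m -> m < 2 * n ->
         ~ expressible_in (lang L c k.+1 n) (lang L c k m)),
      (forall n : nat,
         expressible_in (lang L c k n) (lang L c 0 (n * 2 ^ k)))
    & (forall n m : nat, 0 < n -> n <= m -> m < n * 2 ^ k ->
         ~ expressible_in (lang L c k n) (lang L c 0 m))].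
Proof.
split.
- exact: expressible_lower_arity.
(* Composed with the elimination of arity [k], a translation would reach [m * 2 ^ k] nullary atoms,
   fewer than the [n * 2 ^ k.+1] that are required. *)
- move=> n m _ _ lt_m /expressible_in_trans/(_ (@expressible_nullary L c k m)).
  apply: not_expressible_nullary.
  by rewrite expnS mulnA (mulnC n) ltn_pmul2r ?expn_gt0.
- exact: expressible_nullary.
- by move=> n m _ _; apply: not_expressible_nullary.
Qed.
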